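(* Consider the Euclidean space $\mathbb{R}^n$ and let $\Omega=\mathbb{B}^2_R$ be the closed ball centered at the origin with radius $R>0$. Let $r>R$. Then: (1) There exists a constant $\sigma_0>0$ such that for all $x_1,x_2\in\mathbb{S}^2_r$ and all $\lambda\in(0,1)$, $$d_\Omega\big((1-\lambda)x_1+\lambda x_2\big)\le\max\{d_\Omega(x_1),d_\Omega(x_2)\}-\frac{\sigma_0}{2}\lambda(1-\lambda)\|x_1-x_2\|_2^2.$$ (2) If $x_1,x_2\in\mathbb{S}^2_r$ are such that the segment $[x_1,x_2]$ satisfies $[x_1,x_2]\cap\mathbb{B}^2_R=\emptyset$, then there exists a constant $\sigma_1>0$ such that $d_\Omega$ is $\sigma_1$-strongly quasiconvex on $[x_1,x_2]$.
   Context: $\|\cdot\|_2$ is the Euclidean norm, $\mathbb{B}^2_R=\{x\in\mathbb{R}^n\mid\|x\|_2\le R\}$, $\mathbb{S}^2_r=\{x\in\mathbb{R}^n\mid\|x\|_2=r\}$, $[x_1,x_2]=\{(1-\lambda)x_1+\lambda x_2\mid\lambda\in[0,1]\}$, and $d_\Omega(x)=\inf\{\|x-y\|_2\mid y\in\Omega\}$. Let $C\subset\mathbb{R}^n$ be a nonempty convex set and $\sigma>0$. A function $f\colon C\to[-\infty,\infty]$ is $\sigma$-strongly quasiconvex on $C$ if $$f(\lambda x+(1-\lambda)y)\le\max\{f(x),f(y)\}-\frac{\sigma}{2}\lambda(1-\lambda)\|x-y\|_2^2$$ for all $x,y\in C$ and all $\lambda\in(0,1)$. *)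

(* Defs.v *)
From HB Require Import structures.
From mathcomp Require Export all_boot all_order all_algebra.
From mathcomp Require Export all_classical all_reals.
From mathcomp Require Export ereal convex.
Export Order.TTheory GRing.Theory Num.Theory.

Set Implicit Arguments.
Unset Strict Implicit.
Unset Printing Implicit Defensive.

Open Scope classical_set_scope.
Open Scope ring_scope.

(* The norm `|x| that MathComp-Analysis puts on row vectors is the sup norm,
   hence this separate definition. *)
Definition l2norm (K : realType) (n : nat) (x : 'rV[K]_n) : K :=
  Num.sqrt (\sum_(i < n) x 0 i ^+ 2).

Definition l2ball (K : realType) (n : nat) (R : K) : set 'rV[K]_n :=
  [set x | l2norm x <= R].

Definition l2sphere (K : realType) (n : nat) (r : K) : set 'rV[K]_n :=
  [set x | l2norm x = r].

Definition segment (K : realType) (n : nat) (x1 x2 : 'rV[K]_n) :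
    set 'rV[K]_n :=
  [set (1 - lambda) *: x1 + lambda *: x2 | lambda in `[0, 1]].

(* Meant for nonempty Omega: the real-valued inf of the empty set is 0. *)
Definition l2dist (K : realType) (n : nat) (Omega : set 'rV[K]_n)
    (x : 'rV[K]_n) : K :=
  inf [set l2norm (x - y) | y in Omega].

(* The standing assumptions on C and sigma are part of the predicate.  A
   function on C is a total function of which only the values on C are used
   (C being convex, every argument of f below lies in C). *)
Definition strongly_quasiconvex (K : realType) (n : nat) (sigma : K)
    (C : set 'rV[K]_n) (f : 'rV[K]_n -> \bar K) : Prop :=
  [/\ C !=set0, convex_set (C : set (convex_lmodType 'rV[K]_n)), 0 < sigma &
      forall (x y : 'rV[K]_n) (lambda : K), C x -> C y -> 0 < lambda < 1 ->
        (f (lambda *: x + (1 - lambda) *: y)%R <=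
         maxe (f x) (f y)
         - (sigma / 2 * lambda * (1 - lambda) * l2norm (x - y) ^+ 2)%:E)%E].

(* Main.v *)
(** For [|x| >= R] the distance to the ball is [|x| - R].  The identity
    [|l x + (1 - l) y|^2 = l |x|^2 + (1 - l) |y|^2 - l (1 - l) |x - y|^2]
    makes the squared norm strongly convex; since the norm is bounded by [r] on
    the sets considered, taking square roots only costs a factor [2 r]:
    [M - |z| = (M^2 - |z|^2) / (M + |z|) >= (M^2 - |z|^2) / (2 r)].  In (1) the
    segment may enter the ball, where the distance vanishes; there one uses that
    [l (1 - l) |x1 - x2|^2 <= r^2], at the price of a smaller constant. *)
Require Import Defs.
From mathcomp Require Import ring lra.

Set Implicit Arguments.
Unset Strict Implicit.
Unset Printing Implicit Defensive.

Section Euclidean.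
Context (K : realType) (n : nat).
Implicit Types (x y : 'rV[K]_n) (a l M R r : K).

Lemma l2norm_ge0 x : 0 <= l2norm x.
Proof. exact: sqrtr_ge0. Qed.

Lemma sqr_l2norm x : l2norm x ^+ 2 = \sum_(i < n) x 0 i ^+ 2.
Proof. by rewrite sqr_sqrtr// sumr_ge0// => i _; exact: sqr_ge0. Qed.

Lemma l2normZ a x : 0 <= a -> l2norm (a *: x) = a * l2norm x.
Proof.
move=> a0; apply/eqP; rewrite -(@eqrXn2 _ 2)// ?mulr_ge0 ?l2norm_ge0//.
rewrite exprMn !sqr_l2norm mulr_sumr; apply/eqP/eq_bigr => i _.
by rewrite mxE exprMn.
Qed.

Lemma sqr_l2norm_conv l x y :
  l2norm (l *: x + (1 - l) *: y) ^+ 2 =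
  l * l2norm x ^+ 2 + (1 - l) * l2norm y ^+ 2
  - l * (1 - l) * l2norm (x - y) ^+ 2.
Proof.
rewrite !sqr_l2norm !mulr_sumr -big_split -sumrB /=.
by apply: eq_bigr => i _; rewrite !mxE; ring.
Qed.

Lemma sqr_l2norm_conv_le l M x y : 0 <= l <= 1 ->
  l2norm x <= M -> l2norm y <= M ->
  l2norm (l *: x + (1 - l) *: y) ^+ 2 <=
  M ^+ 2 - l * (1 - l) * l2norm (x - y) ^+ 2.
Proof.
move=> /andP[l0 l1] xM yM.
have M0 : 0 <= M by rewrite (le_trans (l2norm_ge0 x)).
have {}xM : l2norm x ^+ 2 <= M ^+ 2 by rewrite lerXn2r ?nnegrE ?l2norm_ge0.
have {}yM : l2norm y ^+ 2 <= M ^+ 2 by rewrite lerXn2r ?nnegrE ?l2norm_ge0.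
by rewrite sqr_l2norm_conv; nra.
Qed.

Lemma l2norm_conv_le l M x y : 0 <= l <= 1 ->
  l2norm x <= M -> l2norm y <= M -> l2norm (l *: x + (1 - l) *: y) <= M.
Proof.
move=> l01 xM yM.
have M0 : 0 <= M by rewrite (le_trans (l2norm_ge0 x)).
rewrite -(@ler_pXn2r _ 2) ?nnegrE ?l2norm_ge0//.
apply: le_trans (sqr_l2norm_conv_le l01 xM yM) _.
case/andP: l01 => l0 l1.
by rewrite gerBl mulr_ge0 ?sqr_ge0// mulr_ge0 ?subr_ge0.
Qed.

(* [x / (p + q)] is a convex combination of [u / p] and [v / q], so the
   convexity of the norm suffices and Cauchy-Schwarz is not needed. *)
Lemma l2normD_le (p q : K) x y : 0 < p -> 0 < q ->
  l2norm x <= p -> l2norm y <= q -> l2norm (x + y) <= p + q.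
Proof.
move=> p0 q0 xp yq; have pq0 : 0 < p + q by rewrite addr_gt0.
have -> : x + y = (p + q) *: (p / (p + q) *: (p^-1 *: x) +
                              (1 - p / (p + q)) *: (q^-1 *: y)).
  rewrite scalerDr !scalerA.
  have -> : (p + q) * (p / (p + q)) / p = 1 by field; rewrite !gt_eqF.
  have -> : (p + q) * (1 - p / (p + q)) / q = 1 by field; rewrite !gt_eqF.
  by rewrite !scale1r.
rewrite l2normZ ?(ltW pq0)// ger_pMr//; apply: l2norm_conv_le.
- by rewrite divr_ge0 ?(ltW p0) ?(ltW pq0)//= ler_pdivrMr// mul1r lerDl ltW.
- by rewrite l2normZ ?invr_ge0 ?(ltW p0)// ler_pdivrMl// mulr1.
- by rewrite l2normZ ?invr_ge0 ?(ltW q0)// ler_pdivrMl// mulr1.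
Qed.

(** The triangle inequality makes the right-hand side a lower bound; it is attained at [x] itself
    inside the ball and at the radial projection [(R / l2norm x) *: x] outside. *)
Lemma l2dist_l2ball R x : 0 < R ->
  l2dist (l2ball R) x = Num.max 0 (l2norm x - R).
Proof.
move=> R0; set E := [set l2norm (x - y) | y in l2ball R].
have lbE : lbound E (Num.max 0 (l2norm x - R)).
  move=> _ [y yR <-]; rewrite ge_max l2norm_ge0 /= leNgt; apply/negP => xyR.
  (* The midpoint of [l2norm (x - y)] and [l2norm x - R] is positive even if [x = y], as
     [l2normD_le] requires, and still satisfies [p + R < l2norm x]. *)
  pose p := (l2norm (x - y) + (l2norm x - R)) / 2.
  have xy0 := l2norm_ge0 (x - y).
  have p0 : 0 < p by rewrite /p; lra.
  have xyp : l2norm (x - y) <= p by rewrite /p; lra.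
  have := l2normD_le p0 R0 xyp yR; rewrite subrK /p; lra.
suff [y yR xyE] : exists2 y, l2ball R y &
    Num.max 0 (l2norm x - R) = l2norm (x - y).
  apply/eqP; rewrite eq_le; apply/andP; split.
    by apply: ge_inf; [exists (Num.max 0 (l2norm x - R)) | exists y; rewrite ?xyE].
  by apply: lb_le_inf => [|]; [exists (l2norm (x - y)), y | ].
have [xR|Rx] := leP (l2norm x) R.
  exists x => //; rewrite subrr max_l ?subr_le0//.
  by rewrite -(scale0r x) l2normZ// mul0r.
have x0 : 0 < l2norm x := lt_trans R0 Rx.
have Rx1 : R / l2norm x <= 1 by rewrite ler_pdivrMr// mul1r ltW.
exists ((R / l2norm x) *: x).
  by rewrite /l2ball /= l2normZ ?divfK ?gt_eqF ?divr_ge0 ?(ltW R0) ?(ltW x0)//.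
rewrite max_r ?subr_ge0 ?(ltW Rx)// -{2}(scale1r x) -scalerBl.
by rewrite l2normZ ?subr_ge0// mulrBl mul1r divfK ?gt_eqF.
Qed.

Lemma le_sub_of_sqr M r (t z : K) : 0 < r -> 0 <= z -> 0 <= M <= r -> 0 <= t ->
  z ^+ 2 <= M ^+ 2 - t -> z <= M - t / (2 * r).
Proof.
move=> r0 z0 /andP[M0 Mr] t0 zMt.
have zM : z <= M by rewrite -(@ler_pXn2r _ 2) ?nnegrE// (le_trans zMt)// gerBl.
rewrite lerBrDr -lerBrDl ler_pdivrMr ?mulr_gt0//.
(* What remains is [t <= (M - z) * (2 * r)]. It follows from [t <= (M - z) * (M + z)] with
   [0 <= M - z] and [M + z <= 2 * r], without dividing by [M + z], which may vanish. *)
nra.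
Qed.

Lemma convex_segment (x1 x2 : 'rV[K]_n) :
  convex_set (segment x1 x2 : set (convex_lmodType 'rV[K]_n)).
Proof.
move=> _ _ l /set_mem[a /= a01 <-] /set_mem[b /= b01 <-]; apply/mem_set.
have l0 : 0 <= l%:num by [].
have l1 : l%:num <= 1 by [].
move: a01 b01; rewrite !in_itv /= => /andP[a0 a1] /andP[b0 b1].
exists (l%:num * a + (1 - l%:num) * b) => /=.
  by rewrite in_itv /=; apply/andP; split; nra.
(* The convex combination of [convex_lmodType] is convertible to this explicit sum. *)
rewrite [RHS](_ : _ = l%:num *: ((1 - a) *: x1 + a *: x2) +
  (1 - l%:num) *: ((1 - b) *: x1 + b *: x2))//.
by apply/rowP => i; rewrite !mxE; ring.
Qed.

End Euclidean.

Theorem proposition3p2 (K : realType) (n : nat) (R r : K) :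
  0 < R -> R < r ->
  (exists sigma0 : K, 0 < sigma0 /\
     forall (x1 x2 : 'rV[K]_n) (lambda : K),
       l2sphere r x1 -> l2sphere r x2 -> 0 < lambda < 1 ->
       l2dist (l2ball R) ((1 - lambda) *: x1 + lambda *: x2) <=
       Num.max (l2dist (l2ball R) x1) (l2dist (l2ball R) x2)
       - sigma0 / 2 * lambda * (1 - lambda) * l2norm (x1 - x2) ^+ 2) /\
  (forall x1 x2 : 'rV[K]_n,
     l2sphere r x1 -> l2sphere r x2 ->
     segment x1 x2 `&` l2ball R = set0 ->
     exists sigma1 : K, 0 < sigma1 /\
       strongly_quasiconvex sigma1 (segment x1 x2)
         (fun x => (l2dist (l2ball R) x)%:E)).
Proof.
move=> R0 Rr; have r0 : 0 < r := lt_trans R0 Rr.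
have segE (x1 x2 : 'rV[K]_n) l :
    (1 - l) *: x1 + l *: x2 = (1 - l) *: x1 + (1 - (1 - l)) *: x2.
  by rewrite subKr.
split.
  (* This is [r^-1] scaled by [(r ^+ 2 - R ^+ 2) / r ^+ 2]. The scaling factor is at most 1, which
     serves outside the ball, and its product with [r / 2] is at most [r - R], which serves
     inside. *)
  exists ((r ^+ 2 - R ^+ 2) / r ^+ 3); split.
    rewrite divr_gt0 ?exprn_gt0//; nra.
  move=> x1 x2 l; rewrite /l2sphere /= => x1r x2r /andP[l0 l1].
  rewrite !l2dist_l2ball// x1r x2r maxxx (max_r (_ : 0 <= r - R)); last first.
    by rewrite subr_ge0 ltW.
  have l01 : 0 <= 1 - l <= 1 by apply/andP; split; lra.
  have x1r' : l2norm x1 <= r by rewrite x1r.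
  have x2r' : l2norm x2 <= r by rewrite x2r.
  have := sqr_l2norm_conv_le l01 x1r' x2r'.
  rewrite -segE subKr.
  have -> : (r ^+ 2 - R ^+ 2) / r ^+ 3 / 2 * l * (1 - l) *
      l2norm (x1 - x2) ^+ 2 =
      (r ^+ 2 - R ^+ 2) / r ^+ 2 *
      ((1 - l) * l * l2norm (x1 - x2) ^+ 2 / (2 * r)).
    by field; rewrite gt_eqF.
  set z := l2norm _; set t := _ * l2norm _ ^+ 2 => zt.
  have t0 : 0 <= t by rewrite mulr_ge0 ?sqr_ge0// mulr_ge0//; lra.
  have zr : z <= r - t / (2 * r).
    by apply: (le_sub_of_sqr r0 _ _ t0 zt); rewrite ?l2norm_ge0// ltW//=.
  have tr : t <= r ^+ 2 by rewrite -subr_ge0 (le_trans _ zt)// sqr_ge0.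
  have {}t0 : 0 <= t / (2 * r) by rewrite divr_ge0// mulr_ge0// ltW.
  have {}tr : t / (2 * r) <= r / 2.
    rewrite ler_pdivrMr ?mulr_gt0//.
    by rewrite [leRHS](_ : _ = r ^+ 2)//; field.
  have q1 : (r ^+ 2 - R ^+ 2) / r ^+ 2 <= 1.
    by rewrite ler_pdivrMr ?exprn_gt0// mul1r gerBl sqr_ge0.
  have q2 : (r ^+ 2 - R ^+ 2) / r ^+ 2 * (r / 2) <= r - R.
    have -> : (r ^+ 2 - R ^+ 2) / r ^+ 2 * (r / 2) =
        (r - R) * ((r + R) / (2 * r)) by field; rewrite gt_eqF.
    rewrite ler_piMr ?subr_ge0 ?(ltW Rr)// ler_pdivrMr ?mulr_gt0//; lra.
  have q0 : 0 <= (r ^+ 2 - R ^+ 2) / r ^+ 2.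
    rewrite divr_ge0 ?sqr_ge0//; nra.
  (* The bound on 0 comes from [tr] and [q2], the bound on [z - R] from [zr] and [q1]. *)
  rewrite ge_max; apply/andP; split; nra.
move=> x1 x2; rewrite /l2sphere /= => x1r x2r seg0.
have segR x : segment x1 x2 x -> R < l2norm x <= r.
  move=> xs; apply/andP; split.
    rewrite ltNge; apply/negP => xR.
    by have : (segment x1 x2 `&` l2ball R) x by []; rewrite seg0.
  case: xs => l; rewrite /= in_itv /= => /andP[l0 l1] <-; rewrite segE.
  by apply: l2norm_conv_le; rewrite ?x1r ?x2r//; apply/andP; split; lra.
(* Half of this constant is exactly the factor [1 / (2 * r)] of [le_sub_of_sqr]: on the segment the
   distance is [l2norm x - R], so nothing further is lost. *)
exists r^-1; split; first by rewrite invr_gt0.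
split; [|exact: convex_segment|by rewrite invr_gt0|].
  exists x1; exists 0; first by rewrite /= in_itv /= lexx ler01.
  by rewrite subr0 scale1r scale0r addr0.
move=> x y l xs ys /andP[l0 l1].
have l01 : 0 <= l <= 1 by rewrite !ltW.
have zs : segment x1 x2 (l *: x + (1 - l) *: y).
  have /andP[l0' l1'] := l01.
  exact/set_mem/(convex_segment (Itv01 l0' l1') (mem_set xs) (mem_set ys)).
have distE u : segment x1 x2 u -> l2dist (l2ball R) u = l2norm u - R.
  by move=> /segR/andP[uR _]; rewrite l2dist_l2ball// max_r// subr_ge0 ltW.
rewrite !distE// -EFin_max -EFinB lee_fin.
rewrite -addr_maxl.
(* Here [x] and [y] may be interior points of the segment, so [M] can be smaller than [r]. *)
set M := Num.max (l2norm x) (l2norm y).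
have xM : l2norm x <= M by rewrite le_max lexx.
have yM : l2norm y <= M by rewrite le_max lexx orbT.
have Mr : 0 <= M <= r.
  rewrite (le_trans (l2norm_ge0 x) xM) /= ge_max.
  by have /andP[_ ->] := segR _ xs; have /andP[_ ->] := segR _ ys.
have t0 : 0 <= l * (1 - l) * l2norm (x - y) ^+ 2.
  by rewrite mulr_ge0 ?sqr_ge0// mulr_ge0// ?subr_ge0 ltW.
have := le_sub_of_sqr r0 (l2norm_ge0 _) Mr t0
          (sqr_l2norm_conv_le l01 xM yM).
rewrite invfM; set c := r^-1; lra.
Qed.
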